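(* Let $n\ge2$ and $q\ge2$ be integers, let $t\in\mathbb{Z}/q\mathbb{Z}$, and let $\Lambda=\Lambda(n,q,t)$ be the associated domino $2$-graph. Let $R\Lambda=(\Lambda^0,\Lambda^{e_2},r,s)$ be its red graph, and let $\sigma:\Lambda^0\to\Lambda^0$ be the bijection given by $\sigma(v)=s(e)$, where $e$ is the unique element of $\Lambda^{e_1}$ with $r(e)=v$. For each $e\in\Lambda^{e_2}$ there is a unique edge $\sigma_1(e)\in\Lambda^{e_2}$ from $\sigma(s(e))$ to $\sigma(r(e))$, and then $\sigma_1:\Lambda^{e_2}\to\Lambda^{e_2}$ is a bijection. The pair $(\sigma,\sigma_1)$ is an automorphism of the directed graph $R\Lambda$. Let $\alpha$ be the action of $\mathbb{Z}$ on $R\Lambda$ generated by $(\sigma^{-1},\sigma_1^{-1})$. Then $\Lambda$ is isomorphic, as a $2$-graph, to the crossed product $2$-graph $R\Lambda\times_\alpha\mathbb{Z}$.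
   Context: **$k$-graphs.** A $k$-graph is a countable category $\Lambda$ with a functor $d:\Lambda\to\mathbb{N}^k$ (the degree map) satisfying the factorisation property: if $d(\lambda)=m+p$, there are unique $\mu,\nu\in\Lambda$ with $d(\mu)=m$, $d(\nu)=p$ and $\lambda=\mu\nu$. Here $s,r$ are the domain and codomain maps, so $\mu\nu$ is defined when $s(\mu)=r(\nu)$; $\Lambda^m:=d^{-1}(m)$, and objects are identified with $\Lambda^0$. An edge $e$ goes from $s(e)$ to $r(e)$. Isomorphisms of $k$-graphs are degree-preserving isomorphisms of categories. A directed graph $E$ is regarded as a $1$-graph via its path category (with degree = length). **Domino graphs.** Let $n\ge1$, $q\ge2$ be integers and $t\in\mathbb{Z}/q\mathbb{Z}$. Let $T=\{0,e_1,2e_1,\dots,(n-1)e_1\}\subset\mathbb{N}^2$, and for $m\in\mathbb{N}^2$ let $T(m)=\bigcup_{0\le l\le m}(T+l)$. For a function $f$ whose domain contains $T+l$, define $f|_{T+l}:T\to\mathbb{Z}/q\mathbb{Z}$ by $f|_{T+l}(i)=f(i+l)$. The domino graph $\Lambda=\Lambda(n,q,t)$ is the $2$-graph with vertex set $\Lambda^0=\{v:T\to\mathbb{Z}/q\mathbb{Z}:\sum_{i\in T}v(i)=t\}$; a path of degree $m$ is a function $\lambda:T(m)\to\mathbb{Z}/q\mathbb{Z}$ such that $\lambda|_{T+l}\in\Lambda^0$ for all $0\le l\le m$, with $r(\lambda)=\lambda|_T$ and $s(\lambda)=\lambda|_{T+m}$. If $\mu\in\Lambda^m$, $\nu\in\Lambda^p$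 and $s(\mu)=r(\nu)$, then $\mu\nu$ is the unique path $\lambda$ of degree $m+p$ with $\lambda(i)=\mu(i)$ for $i\in T(m)$ and $\lambda(i+m)=\nu(i)$ for $i\in T(p)$. It is known that this is a $2$-graph and that every vertex is the range of exactly one and the source of exactly one element of $\Lambda^{e_1}$. Elements of $\Lambda^{e_1}$ are called blue edges and elements of $\Lambda^{e_2}$ red edges. **Crossed product graphs.** If $\alpha$ is an action of $\mathbb{Z}$ on a $1$-graph $\Gamma$ by automorphisms (with $\alpha^m$ the automorphism corresponding to $m\in\mathbb{Z}$), the crossed product $2$-graph $\Gamma\times_\alpha\mathbb{Z}$ has underlying set $\Gamma\times\mathbb{N}$, degree map $d(\lambda,m)=(m,d(\lambda))$, range $r(\lambda,m)=(r(\lambda),0)$, source $s(\lambda,m)=(\alpha^{-m}(s(\lambda)),0)$, and composition $(\mu,m)(\nu,p)=(\mu\,\alpha^m(\nu),m+p)$ whenever $s(\mu,m)=r(\nu,p)$. *)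

(* Defs.v *)
From HB Require Import structures.
From mathcomp Require Import all_boot all_order all_algebra finmap zify.
Set Implicit Arguments.
Unset Strict Implicit.
Unset Printing Implicit Defensive.
Import GRing.Theory.
Local Open Scope ring_scope.

Definition mdeg (k : nat) := {ffun 'I_k -> nat}.
Definition unit_deg k (i : 'I_k) : mdeg k := [ffun j => (j == i : nat)].

(* Objects and morphisms live in countable types, which makes the category
   countable.  An object [v] is identified with the degree-0 morphism [idm v]. *)
Record kgraph (k : nat) := KGraph {
  obj : countType;
  mor : countType;
  rng : mor -> obj;
  src : mor -> obj;
  deg : mor -> mdeg k;
  idm : obj -> mor;
  comp : forall mu nu : mor, src mu = rng nu -> mor;
  rng_id : forall v, rng (idm v) = v;
  src_id : forall v, src (idm v) = v;
  rng_comp : forall mu nu (h : src mu = rng nu), rng (comp h) = rng mu;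
  src_comp : forall mu nu (h : src mu = rng nu), src (comp h) = src nu;
  comp_idl : forall mu (h : src (idm (rng mu)) = rng mu), comp h = mu;
  comp_idr : forall mu (h : src mu = rng (idm (src mu))), comp h = mu;
  compA : forall mu nu rho (h1 : src mu = rng nu) (h2 : src (comp h1) = rng rho)
    (h3 : src nu = rng rho) (h4 : src mu = rng (comp h3)), comp h2 = comp h4;
  deg_id : forall v, deg (idm v) = 0;
  deg_comp : forall mu nu (h : src mu = rng nu), deg (comp h) = deg mu + deg nu;
  factorisation : forall la m p, deg la = m + p ->
    exists! mn : mor * mor, [/\ deg mn.1 = m, deg mn.2 = p &
      exists h : src mn.1 = rng mn.2, la = comp h]
}.
Arguments rng {k L} _ : rename.
Arguments src {k L} _ : rename.
Arguments deg {k L} _ : rename.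
Arguments idm {k L} _ : rename.
Arguments comp {k L mu nu} _ : rename.

Definition layer k (L : kgraph k) (m : mdeg k) := {e : mor L | deg e == m}.

Record kmorphism k (G H : kgraph k) := KMorphism {
  fobj : obj G -> obj H;
  fmor : mor G -> mor H;
  fmor_rng : forall mu, rng (fmor mu) = fobj (rng mu);
  fmor_src : forall mu, src (fmor mu) = fobj (src mu);
  fmor_id : forall v, fmor (idm v) = idm (fobj v);
  fmor_comp : forall mu nu (h : src mu = rng nu)
    (h' : src (fmor mu) = rng (fmor nu)), fmor (comp h) = comp h';
  fmor_deg : forall mu, deg (fmor mu) = deg mu
}.

Arguments fmor_comp {k G H} f {mu nu} h h' : rename.

Record kiso k (G H : kgraph k) := KIso {
  kfun :> kmorphism G H;
  kinv : kmorphism H G;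
  kfunK : cancel (fmor kfun) (fmor kinv);
  kinvK : cancel (fmor kinv) (fmor kfun)
}.

(* [kfunK] and [kinvK] only mention morphisms: objects embed as identities. *)
Lemma fobjE k (G H : kgraph k) (f : kmorphism G H) v :
  fobj f v = rng (fmor f (idm v)).
Proof. by rewrite fmor_id rng_id. Qed.

Lemma kfun_objK k (G H : kgraph k) (f : kiso G H) :
  cancel (fobj f) (fobj (kinv f)).
Proof. by move=> v; rewrite fobjE -fmor_id kfunK rng_id. Qed.

Lemma kinv_objK k (G H : kgraph k) (f : kiso G H) :
  cancel (fobj (kinv f)) (fobj f).
Proof. by move=> v; rewrite fobjE -fmor_id kinvK rng_id. Qed.

Definition kmorphism_id k (G : kgraph k) : kmorphism G G.
Proof.
refine (@KMorphism k G G id id _ _ _ _ _) => // mu nu h h'.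
by rewrite (eq_irrelevance h h').
Defined.

Definition kmorphism_comp k (G H K : kgraph k) (g : kmorphism H K)
  (f : kmorphism G H) : kmorphism G K.
Proof.
refine (@KMorphism k G K (fobj g \o fobj f) (fmor g \o fmor f) _ _ _ _ _) => /=.
- by move=> mu; rewrite !fmor_rng.
- by move=> mu; rewrite !fmor_src.
- by move=> v; rewrite !fmor_id.
- move=> mu nu h h'.
  have h1 : src (fmor f mu) = rng (fmor f nu) by rewrite fmor_src h fmor_rng.
  by rewrite (fmor_comp f h h1) (fmor_comp g h1 h').
- by move=> mu; rewrite !fmor_deg.
Defined.

Definition kiso_id k (G : kgraph k) : kiso G G :=
  @KIso k G G (kmorphism_id G) (kmorphism_id G) (fun=> erefl) (fun=> erefl).

Definition kiso_inv k (G H : kgraph k) (f : kiso G H) : kiso H G :=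
  KIso (@kinvK _ _ _ f) (@kfunK _ _ _ f).

Definition kiso_comp k (G H K : kgraph k) (g : kiso H K) (f : kiso G H) :
  kiso G K :=
  @KIso k G K (kmorphism_comp g f) (kmorphism_comp (kinv f) (kinv g))
    (can_comp (@kfunK _ _ _ g) (@kfunK _ _ _ f))
    (can_comp (@kinvK _ _ _ f) (@kinvK _ _ _ g)).

Definition kiso_exp k (G : kgraph k) (f : kiso G G) (m : int) : kiso G G :=
  match m with
  | Posz n => iter n (kiso_comp f) (kiso_id G)
  | Negz n => kiso_inv (iter n.+1 (kiso_comp f) (kiso_id G))
  end.

(* [zactD] determines the action on objects as well, see [zact_objD]. *)
Record zaction k (G : kgraph k) := ZAction {
  zact :> int -> kiso G G;
  zact0 : forall mu, fmor (zact 0) mu = mu;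
  zactD : forall m p mu,
    fmor (zact (m + p)) mu = fmor (zact m) (fmor (zact p) mu)
}.

Section Power.
Variables (k : nat) (G : kgraph k) (f : kiso G G).
Let F := fmor f.
Let F' := fmor (kinv f).

Let fmor_iter n mu : fmor (iter n (kiso_comp f) (kiso_id G)) mu = iter n F mu.
Proof. by elim: n => //= n ->. Qed.

Let finv_iter n mu :
  fmor (kinv (iter n (kiso_comp f) (kiso_id G))) mu = iter n F' mu.
Proof. by elim: n mu => //= n IH mu; rewrite IH -iterSr. Qed.

Let expS m mu : fmor (kiso_exp f (m + 1)) mu = F (fmor (kiso_exp f m) mu).
Proof.
case: m => [n|[|n]].
- by rewrite -PoszD addn1 /= fmor_iter.
- by rewrite /= /F kinvK.
- have -> : Negz n.+1 + 1 = Negz n by lia.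
  rewrite /kiso_exp [fmor (kiso_inv _) _]finv_iter.
  rewrite [fmor (kiso_inv (iter n.+2 _ _)) _]finv_iter [in RHS]iterS.
  by rewrite /F /F' kinvK.
Qed.

Let expP m mu : fmor (kiso_exp f (m - 1)) mu = F' (fmor (kiso_exp f m) mu).
Proof. by rewrite -{2}[m](subrK 1) expS /F /F' kfunK. Qed.

Lemma kiso_expD m p mu :
  fmor (kiso_exp f (m + p)) mu = fmor (kiso_exp f m) (fmor (kiso_exp f p) mu).
Proof.
elim/int_rec: m => [|n IH|n IH]; first by rewrite add0r.
- have -> : n.+1%:Z = n%:Z + 1 by lia.
  by rewrite addrAC !expS IH.
- have -> : - n.+1%:Z = - n%:Z - 1 by lia.
  by rewrite addrAC !expP IH.
Qed.

Definition generated_action : zaction G :=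
  @ZAction k G (kiso_exp f) (fun=> erefl) kiso_expD.

End Power.

Lemma zact_objD k (G : kgraph k) (a : zaction G) m p v :
  fobj (a (m + p)) v = fobj (a m) (fobj (a p) v).
Proof. by rewrite fobjE zactD fmor_rng -fobjE. Qed.

Lemma zact_obj0 k (G : kgraph k) (a : zaction G) v : fobj (a 0) v = v.
Proof. by rewrite fobjE zact0 rng_id. Qed.

Lemma zact_objK k (G : kgraph k) (a : zaction G) m :
  cancel (fobj (a m)) (fobj (a (- m))).
Proof. by move=> v; rewrite -zact_objD addNr zact_obj0. Qed.

Lemma zactK k (G : kgraph k) (a : zaction G) m :
  cancel (fmor (a m)) (fmor (a (- m))).
Proof. by move=> v; rewrite -zactD addNr zact0. Qed.

Lemma zact_objKV k (G : kgraph k) (a : zaction G) m :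
  cancel (fobj (a (- m))) (fobj (a m)).
Proof. by move=> v; rewrite -zact_objD addrN zact_obj0. Qed.

Lemma zactKV k (G : kgraph k) (a : zaction G) m :
  cancel (fmor (a (- m))) (fmor (a m)).
Proof. by move=> v; rewrite -zactD addrN zact0. Qed.

Definition blue : 'I_2 := ord0.
Definition red : 'I_2 := ord_max.

Definition pair_deg (a b : nat) : mdeg 2 := [ffun i => if i == blue then a else b].

Lemma mdegD k (m p : mdeg k) j : (m + p) j = (m j + p j)%N.
Proof. by rewrite ffunE. Qed.

Lemma mdeg0 k j : (0 : mdeg k) j = 0%N.
Proof. by rewrite ffunE. Qed.

Lemma pair_deg_blue a b : pair_deg a b blue = a.
Proof. by rewrite ffunE. Qed.

Lemma pair_deg_red a b : pair_deg a b red = b.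
Proof. by rewrite ffunE. Qed.

Definition degE := (mdegD, mdeg0, pair_deg_blue, pair_deg_red).

Lemma blue_or_red (i : 'I_2) : i = blue \/ i = red.
Proof. by case: i => -[|[|//]] h; [left | right]; apply: val_inj. Qed.

Lemma pair_degE (m : mdeg 2) : m = pair_deg (m blue) (m red).
Proof. by apply/ffunP => i; case: (blue_or_red i) => ->; rewrite degE. Qed.

Lemma pair_degD a b c d :
  pair_deg a b + pair_deg c d = pair_deg (a + c) (b + d).
Proof. by rewrite [LHS]pair_degE !degE. Qed.

Lemma pair_deg_eq a b c d : pair_deg a b = pair_deg c d -> a = c /\ b = d.
Proof. by move=> /ffunP E; have := E red; have := E blue; rewrite !degE. Qed.

Lemma comp_eq k (L : kgraph k) (mu nu mu' nu' : mor L) (h : src mu = rng nu)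
  (h' : src mu' = rng nu') : mu = mu' -> nu = nu' -> comp h = comp h'.
Proof. by move=> e1 e2; subst; rewrite (eq_irrelevance h h'). Qed.

Lemma deg1_eq (m p : mdeg 1) : m ord0 = p ord0 -> m = p.
Proof. by move=> e; apply/ffunP => i; rewrite ord1. Qed.

Section Crossed.
Variables (G : kgraph 1) (a : zaction G).

(* The object (v, 0) of the crossed product is represented by v : obj G. *)
Definition crossed_mor : countType := (mor G * nat)%type.
Definition crossed_rng (x : crossed_mor) : obj G := rng x.1.
Definition crossed_src (x : crossed_mor) : obj G :=
  fobj (a (- x.2%:Z)) (src x.1).
Definition crossed_deg (x : crossed_mor) : mdeg 2 := pair_deg x.2 (deg x.1 ord0).
Definition crossed_id (v : obj G) : crossed_mor := (idm v, 0).

Lemma crossed_composable (x y : crossed_mor) :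
  crossed_src x = crossed_rng y -> src x.1 = rng (fmor (a x.2) y.1).
Proof. by move=> h; rewrite fmor_rng -[rng y.1]h zact_objKV. Qed.

Definition crossed_comp (x y : crossed_mor)
  (h : crossed_src x = crossed_rng y) : crossed_mor :=
  (comp (crossed_composable h), (x.2 + y.2)%N).

Fact crossed_rng_id v : crossed_rng (crossed_id v) = v.
Proof. exact: rng_id. Qed.

Fact crossed_src_id v : crossed_src (crossed_id v) = v.
Proof. by rewrite /crossed_src /= src_id zact_obj0. Qed.

Fact crossed_rng_comp x y (h : crossed_src x = crossed_rng y) :
  crossed_rng (crossed_comp h) = crossed_rng x.
Proof. exact: rng_comp. Qed.

Fact crossed_src_comp x y (h : crossed_src x = crossed_rng y) :
  crossed_src (crossed_comp h) = crossed_src y.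
Proof.
rewrite /crossed_src /= src_comp fmor_src -zact_objD; congr (fobj (a _) _); lia.
Qed.

Fact crossed_comp_idl x (h : crossed_src (crossed_id (crossed_rng x)) =
  crossed_rng x) : crossed_comp h = x.
Proof.
case: x h => la m h; rewrite /crossed_comp; congr pair.
have h' : src (idm (rng la)) = rng la by rewrite src_id.
by rewrite -[RHS](comp_idl h'); apply: comp_eq; rewrite // zact0.
Qed.

Fact crossed_comp_idr x (h : crossed_src x =
  crossed_rng (crossed_id (crossed_src x))) : crossed_comp h = x.
Proof.
case: x h => la m h; rewrite /crossed_comp; congr pair; last by rewrite addn0.
have h' : src la = rng (idm (src la)) by rewrite rng_id.
rewrite -[RHS](comp_idr h'); apply: comp_eq => //.
by rewrite fmor_id zact_objKV.
Qed.

Fact crossed_compA x y z (h1 : crossed_src x = crossed_rng y)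
  (h2 : crossed_src (crossed_comp h1) = crossed_rng z)
  (h3 : crossed_src y = crossed_rng z)
  (h4 : crossed_src x = crossed_rng (crossed_comp h3)) :
  crossed_comp h2 = crossed_comp h4.
Proof.
rewrite /crossed_comp; congr pair; last by rewrite /= addnA.
have e1 := crossed_composable h1.
have e3 : src (fmor (a x.2) y.1) = rng (fmor (a x.2) (fmor (a y.2) z.1)).
  by rewrite fmor_src fmor_rng -(crossed_composable h3).
have e2 : src (comp e1) = rng (fmor (a x.2) (fmor (a y.2) z.1)).
  by rewrite src_comp e3.
have e4 : src x.1 = rng (comp e3) by rewrite rng_comp e1.
transitivity (comp e2).
  by apply: comp_eq => /=; [exact: comp_eq | rewrite -zactD PoszD].
rewrite (compA e2 e4); apply: comp_eq => //=.
by rewrite (fmor_comp _ _ e3).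
Qed.

Fact crossed_deg_id v : crossed_deg (crossed_id v) = 0.
Proof. by apply/ffunP => i; rewrite !ffunE /= deg_id ffunE if_same. Qed.

Fact crossed_deg_comp x y (h : crossed_src x = crossed_rng y) :
  crossed_deg (crossed_comp h) = crossed_deg x + crossed_deg y.
Proof. by rewrite /crossed_deg pair_degD /= deg_comp !ffunE fmor_deg. Qed.

Fact crossed_factorisation x m p : crossed_deg x = m + p ->
  exists! mn : crossed_mor * crossed_mor,
    [/\ crossed_deg mn.1 = m, crossed_deg mn.2 = p &
      exists h : crossed_src mn.1 = crossed_rng mn.2, x = crossed_comp h].
Proof.
case: x => la M; rewrite /crossed_deg /= (pair_degE m) (pair_degE p) pair_degD.
set m1 := m _; set m2 := m _; set p1 := p _; set p2 := p _.
move=> /pair_deg_eq [eM el].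
have : deg la = [ffun=> m2] + [ffun=> p2] by apply: deg1_eq; rewrite el !ffunE.
move=> /factorisation [[mu nu] [[/= dm dn [h hl]] U]].
have h1 : crossed_src (mu, m1) = crossed_rng (fmor (a (- m1%:Z)) nu, p1).
  by rewrite /crossed_src /crossed_rng /= fmor_rng h.
exists ((mu, m1), (fmor (a (- m1%:Z)) nu, p1)); split.
  split; rewrite /= ?fmor_deg ?dm ?dn ?ffunE //.
  exists h1; rewrite /crossed_comp /= eM; congr pair.
  by rewrite hl; apply: comp_eq; rewrite //= zactKV.
case=> [[mu' m1'] [nu' p1']] /= [/pair_deg_eq [-> d1] /pair_deg_eq [-> d2]].
case=> h2; rewrite /crossed_comp /= => -[e _].
have [-> ->] : (mu, nu) = (mu', fmor (a m1) nu').
  have := crossed_composable h2 => /= h3.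
  apply: U; split=> /=.
  - by apply: deg1_eq; rewrite ffunE.
  - by apply: deg1_eq; rewrite ffunE fmor_deg.
  - by exists h3; rewrite e; apply: comp_eq.
by rewrite zactK.
Qed.

Definition crossed_product : kgraph 2 := KGraph crossed_rng_id crossed_src_id
  crossed_rng_comp crossed_src_comp crossed_comp_idl crossed_comp_idr
  crossed_compA crossed_deg_id crossed_deg_comp crossed_factorisation.

End Crossed.

Record digraph := Digraph {
  vert : countType;
  edge : countType;
  dsrc : edge -> vert;
  drng : edge -> vert
}.
Arguments dsrc {d} _.
Arguments drng {d} _.

Record dmorphism (D E : digraph) := DMorphism {
  dvert : vert D -> vert E;
  dedge : edge D -> edge E;
  dedge_src : forall e, dsrc (dedge e) = dvert (dsrc e);
  dedge_rng : forall e, drng (dedge e) = dvert (drng e)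
}.

Record diso (D E : digraph) := DIso {
  dfun :> dmorphism D E;
  dinv : dmorphism E D;
  dvertK : cancel (dvert dfun) (dvert dinv);
  dvertKV : cancel (dvert dinv) (dvert dfun);
  dedgeK : cancel (dedge dfun) (dedge dinv);
  dedgeKV : cancel (dedge dinv) (dedge dfun)
}.

Definition diso_inv D E (f : diso D E) : diso E D :=
  DIso (@dvertKV _ _ f) (@dvertK _ _ f) (@dedgeKV _ _ f) (@dedgeK _ _ f).

(* In the path category of D, a path is given by its range [v] and its list of edges
   [e_1; ...; e_l], where [drng e_1 = v] and [dsrc e_i = drng e_(i+1)]. *)
Section PathGraph.
Variable D : digraph.

Fixpoint is_dpath (v : vert D) (s : seq (edge D)) : bool :=
  if s is e :: s' then (drng e == v) && is_dpath (dsrc e) s' else true.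

Definition dpath : countType := {x : vert D * seq (edge D) | is_dpath x.1 x.2}.

Definition DPath v s (h : is_dpath v s) : dpath :=
  exist (fun x : vert D * seq (edge D) => is_dpath x.1 x.2) (v, s) h.

Definition dpath_rng (x : dpath) : vert D := (val x).1.
Definition dpath_src (x : dpath) : vert D :=
  last (val x).1 [seq dsrc e | e <- (val x).2].
Definition dpath_deg (x : dpath) : mdeg 1 := [ffun=> size (val x).2].
Definition dpath_id (v : vert D) : dpath :=
  @DPath v [::] erefl.

Lemma is_dpath_cat v s1 s2 : is_dpath v (s1 ++ s2) =
  is_dpath v s1 && is_dpath (last v [seq dsrc e | e <- s1]) s2.
Proof. by elim: s1 v => //= e s1 IH v; rewrite IH andbA. Qed.

Lemma dpath_cat_subproof (x y : dpath) : dpath_src x = dpath_rng y ->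
  is_dpath (val x).1 ((val x).2 ++ (val y).2).
Proof. by move=> h; rewrite is_dpath_cat (valP x) [last _ _]h (valP y). Qed.

Definition dpath_comp (x y : dpath) (h : dpath_src x = dpath_rng y) : dpath :=
  DPath (dpath_cat_subproof h).

Fact dpath_rng_id v : dpath_rng (dpath_id v) = v. Proof. by []. Qed.
Fact dpath_src_id v : dpath_src (dpath_id v) = v. Proof. by []. Qed.

Fact dpath_rng_comp x y (h : dpath_src x = dpath_rng y) :
  dpath_rng (dpath_comp h) = dpath_rng x.
Proof. by []. Qed.

Fact dpath_src_comp x y (h : dpath_src x = dpath_rng y) :
  dpath_src (dpath_comp h) = dpath_src y.
Proof. by rewrite {1}/dpath_src /= map_cat last_cat; congr (last _ _). Qed.

Fact dpath_comp_idl x (h : dpath_src (dpath_id (dpath_rng x)) = dpath_rng x) :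
  dpath_comp h = x.
Proof. by apply: val_inj => /=; rewrite [RHS]surjective_pairing. Qed.

Fact dpath_comp_idr x (h : dpath_src x = dpath_rng (dpath_id (dpath_src x))) :
  dpath_comp h = x.
Proof. by apply: val_inj => /=; rewrite cats0 [RHS]surjective_pairing. Qed.

Fact dpath_compA x y z (h1 : dpath_src x = dpath_rng y)
  (h2 : dpath_src (dpath_comp h1) = dpath_rng z)
  (h3 : dpath_src y = dpath_rng z)
  (h4 : dpath_src x = dpath_rng (dpath_comp h3)) :
  dpath_comp h2 = dpath_comp h4.
Proof. by apply: val_inj => /=; rewrite catA. Qed.

Fact dpath_deg_id v : dpath_deg (dpath_id v) = 0.
Proof. by apply/ffunP => i; rewrite !ffunE. Qed.

Fact dpath_deg_comp x y (h : dpath_src x = dpath_rng y) :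
  dpath_deg (dpath_comp h) = dpath_deg x + dpath_deg y.
Proof. by apply/ffunP => i; rewrite !ffunE /= size_cat. Qed.

Fact dpath_factorisation x m p : dpath_deg x = m + p ->
  exists! mn : dpath * dpath, [/\ dpath_deg mn.1 = m, dpath_deg mn.2 = p &
    exists h : dpath_src mn.1 = dpath_rng mn.2, x = dpath_comp h].
Proof.
case: x => -[v s] /= hs /ffunP/(_ ord0); rewrite mdegD ffunE /= => es.
have := hs; rewrite -{1}(cat_take_drop (m ord0) s) is_dpath_cat => /andP[h1 h2].
pose x1 := DPath h1.
pose x2 := DPath h2.
exists (x1, x2); split.
  split=> /=.
  - apply: deg1_eq; rewrite ffunE /= size_take es; case: ltnP => //; lia.
  - apply: deg1_eq; rewrite ffunE /= size_drop es; lia.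
  - have h : dpath_src x1 = dpath_rng x2 by [].
    by exists h; apply: val_inj => /=; rewrite cat_take_drop.
case=> -[[v1 s1] p1] [[v2 s2] p2] /= [d1 d2 [h]].
move/(congr1 val) => /= -[ev esq].
have e1 : size s1 = m ord0 by rewrite -d1 ffunE.
move: h; rewrite /dpath_src /dpath_rng /= => h.
congr pair; apply: val_inj => /=.
  by rewrite ev esq -e1 take_size_cat.
by rewrite -h ev esq -e1 take_size_cat ?drop_size_cat.
Qed.

Definition path_graph : kgraph 1 := KGraph dpath_rng_id dpath_src_id
  dpath_rng_comp dpath_src_comp dpath_comp_idl dpath_comp_idr
  dpath_compA dpath_deg_id dpath_deg_comp dpath_factorisation.

End PathGraph.

Lemma map_dpath_subproof D E (f : dmorphism D E) (x : dpath D) :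
  is_dpath (dvert f (val x).1) [seq dedge f e | e <- (val x).2].
Proof.
case: x => -[v s] /=; elim: s v => //= e s IH v /andP[/eqP <- /IH].
by rewrite dedge_src dedge_rng eqxx.
Qed.

Definition map_dpath D E (f : dmorphism D E) (x : dpath D) : dpath E :=
  DPath (map_dpath_subproof f x).

Definition path_functor D E (f : dmorphism D E) :
  kmorphism (path_graph D) (path_graph E).
Proof.
refine (@KMorphism 1 (path_graph D) (path_graph E) (dvert f) (map_dpath f)
  _ _ _ _ _) => //=.
- move=> x; rewrite /dpath_src /= -(last_map (dvert f)) -!map_comp.
  by congr (last _ _); apply: eq_map => e /=; rewrite dedge_src.
- by move=> v; apply: val_inj.
- by move=> x y h h'; apply: val_inj => /=; rewrite map_cat.
- by move=> x; apply/ffunP => i; rewrite !ffunE /= size_map.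
Defined.

Lemma map_dpathK D E (f : dmorphism D E) (g : dmorphism E D) :
  cancel (dvert f) (dvert g) -> cancel (dedge f) (dedge g) ->
  cancel (map_dpath f) (map_dpath g).
Proof.
move=> vK eK [[v s] hs]; apply: val_inj => /=.
by rewrite vK mapK.
Qed.

Definition path_iso D E (f : diso D E) : kiso (path_graph D) (path_graph E) :=
  @KIso 1 (path_graph D) (path_graph E) (path_functor f) (path_functor (dinv f))
    (map_dpathK (@dvertK _ _ f) (@dedgeK _ _ f))
    (map_dpathK (@dvertKV _ _ f) (@dedgeKV _ _ f)).

Definition coordinate_graph k (L : kgraph k) (i : 'I_k) : digraph :=
  @Digraph (obj L) (layer L (unit_deg i))
    (fun e => src (val e)) (fun e => rng (val e)).

Definition box k (m : mdeg k) : {fset mdeg k} :=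
  [fset [ffun j => (f : {dffun forall j, 'I_(m j).+1}) j : nat] |
    f in {: {dffun forall j : 'I_k, 'I_(m j).+1}}]%fset.

Lemma in_box k (m l : mdeg k) : (l \in box m) = [forall j, l j <= m j]%N.
Proof.
apply/imfsetP/forallP => /= [[f _ -> j]|H]; first by rewrite ffunE -ltnS.
exists [ffun j => inord (l j) : 'I_(m j).+1] => //.
by apply/ffunP => j; rewrite !ffunE inordK // ltnS.
Qed.

Lemma box0 k (m : mdeg k) : 0 \in box m.
Proof. by rewrite in_box; apply/forallP => j; rewrite ffunE. Qed.

Lemma box_top k (m : mdeg k) : m \in box m.
Proof. by rewrite in_box; apply/forallP. Qed.

(* extension by 0, so that values can be taken without membership proofs *)
Definition extend (A : {fset mdeg 2}) q (f : {ffun A -> 'Z_q}) (x : mdeg 2) : 'Z_q :=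
  if insub x is Some y then f y else 0.

Lemma extendE (A : {fset mdeg 2}) q (f : {ffun A -> 'Z_q}) (y : A) :
  extend f (val y) = f y.
Proof. by rewrite /extend valK. Qed.

Lemma unit_deg_blue : unit_deg blue = pair_deg 1 0.
Proof. by apply/ffunP => i; rewrite !ffunE; case: eqP. Qed.

Lemma deg_flat (x : mdeg 2) : x red = 0%N -> x = pair_deg (x blue) 0.
Proof. by move=> h; rewrite [LHS]pair_degE h. Qed.

Lemma unit_deg_mul i : unit_deg blue *+ i = pair_deg i 0.
Proof.
elim: i => [|i IH]; first by rewrite [LHS]pair_degE !degE.
by rewrite mulrS IH unit_deg_blue pair_degD.
Qed.

Lemma sum_period n q (u : nat -> 'Z_q) a :
  \sum_(i < n) u (i + a)%N = \sum_(i < n) u (i + a.+1)%N -> u (a + n)%N = u a.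
Proof.
case: n => [|n]; first by rewrite addn0.
rewrite big_ord_recl big_ord_recr /= addrC.
have -> : \sum_(i < n) u (bump 0 i + a)%N = \sum_(i < n) u (i + a.+1)%N.
  by apply: eq_bigr => i _; congr u; rewrite /bump; lia.
move/eqP; rewrite (inj_eq (addIr _)) add0n => /eqP ->; congr u; lia.
Qed.

Section Domino.
Variables (n q : nat) (t : 'Z_q).

Definition tile : {fset mdeg 2} := [fset (unit_deg blue *+ (i : 'I_n))%R | i in 'I_n]%fset.

(* T(m), the union of the T + l for 0 <= l <= m, where T = tile *)
Definition region (m : mdeg 2) : {fset mdeg 2} :=
  (\bigcup_(l <- box m) [fset (i + l)%R | i in tile])%fset.

Definition is_vertex (v : {ffun tile -> 'Z_q}) : bool := \sum_(i : tile) v i == t.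

Definition vertex : countType := {v : {ffun tile -> 'Z_q} | is_vertex v}.

Lemma shift_subproof m (l : box m) (i : tile) : val i + val l \in region m.
Proof. by apply/bigfcupP; exists (val l); rewrite ?fsvalP //; apply: in_imfset => /=; apply: fsvalP. Qed.

Definition shift m (l : box m) (i : tile) : region m := [` shift_subproof l i]%fset.

(* f|_{T + l} *)
Definition window m (f : {ffun region m -> 'Z_q}) (l : box m) : {ffun tile -> 'Z_q} :=
  [ffun i => f (shift l i)].

Definition is_domino_path m (f : {ffun region m -> 'Z_q}) : bool :=
  [forall l : box m, is_vertex (window f l)].

Definition domino_path (m : mdeg 2) :=
  {f : {ffun region m -> 'Z_q} | is_domino_path f}.

Definition domino_mor : countType := {m : mdeg 2 & domino_path m}.

Definition domino_deg (x : domino_mor) : mdeg 2 := tag x.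

Definition domino_vertex (x : domino_mor) (l : box (tag x)) : vertex :=
  exist (fun v => is_vertex v) (window (val (tagged x)) l)
    (forallP (valP (tagged x)) l).

Definition domino_rng (x : domino_mor) : vertex :=
  domino_vertex [` box0 (tag x)]%fset.
Definition domino_src (x : domino_mor) : vertex :=
  domino_vertex [` box_top (tag x)]%fset.

Lemma in_tile (x : mdeg 2) : (x \in tile) = (x blue < n)%N && (x red == 0%N).
Proof.
apply/imfsetP/andP => /= [[i _ ->]|[h /eqP h0]].
  by rewrite unit_deg_mul !degE ltn_ord.
exists (Ordinal h) => //=; rewrite unit_deg_mul [LHS]pair_degE; congr pair_deg.
exact: h0.
Qed.

Lemma in_region m (x : mdeg 2) :
  (x \in region m) = [&& 0 < n, x blue < n + m blue & x red <= m red]%N.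
Proof.
apply/bigfcupP/and3P => /= [[l /andP[]]|[n0 h0 h1]].
  rewrite in_box => /forallP lm _ /imfsetP[i /=]; rewrite in_tile => /andP[ib /eqP ir] ->.
  have := lm blue; have := lm red.
  by rewrite !degE ir; split; lia.
pose a := (x blue - m blue)%N.
exists (pair_deg (x blue - a) (x red)).
  rewrite andbT in_box; apply/forallP => j.
  by case: (blue_or_red j) => ->; rewrite degE // /a; lia.
apply/imfsetP; exists (pair_deg a 0).
  by rewrite /= in_tile !degE /a; lia.
rewrite pair_degD [LHS]pair_degE add0n; congr pair_deg.
by rewrite /a; lia.
Qed.

Lemma sum_tile (v : {ffun tile -> 'Z_q}) :
  \sum_(i : tile) v i = \sum_(a < n) extend v (pair_deg a 0).
Proof.
transitivity (\sum_(i : tile) extend v (val i)).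
  by apply: eq_bigr => i _; rewrite extendE.
rewrite -(big_seq_fsetE _ _ xpredT (extend v)) /= /tile big_imfset /=.
  by rewrite big_enum /=; apply: eq_bigr => i _; rewrite unit_deg_mul.
by move=> i j _ _; rewrite !unit_deg_mul => /pair_deg_eq[/ord_inj].
Qed.

Implicit Types (x y z : domino_mor) (m p : mdeg 2).

Definition dblue x : nat := (tag x : mdeg 2) blue.
Definition dred x : nat := (tag x : mdeg 2) red.

Definition coord (x : domino_mor) (a b : nat) : 'Z_q :=
  extend (val (tagged x)) (pair_deg a b).

Lemma extend_window m (f : {ffun region m -> 'Z_q}) (l : box m) a : (a < n)%N ->
  extend (window f l) (pair_deg a 0) = extend f (pair_deg (a + val l blue) (val l red)).
Proof.
move=> an.
have it : pair_deg a 0 \in tile by rewrite in_tile !degE an.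
have -> : pair_deg a 0 = val [` it]%fset by [].
rewrite extendE ffunE -extendE; congr extend.
by rewrite /= [fsval l]pair_degE pair_degD !degE.
Qed.

Lemma coord_sum x a b : (a <= dblue x)%N -> (b <= dred x)%N ->
  \sum_(i < n) coord x (i + a) b = t.
Proof.
move=> ha hb.
have bx : pair_deg a b \in box (tag x).
  by rewrite in_box; apply/forallP => j; case: (blue_or_red j) => ->; rewrite degE.
have /eqP <- := forallP (valP (tagged x)) [` bx]%fset.
rewrite sum_tile; apply: eq_bigr => i _.
by rewrite extend_window // !degE.
Qed.

Lemma coord_period x a b : (a < dblue x)%N -> (b <= dred x)%N ->
  coord x (a + n) b = coord x a b.
Proof.
move=> ha hb; apply: (@sum_period n q (fun c => coord x c b) a).
by rewrite (coord_sum (ltnW ha) hb) (coord_sum ha hb).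
Qed.

Lemma coord_mod x a b : (a < n + dblue x)%N -> (b <= dred x)%N ->
  coord x a b = coord x (a %% n) b.
Proof.
have [->|n0] := posnP n; first by rewrite modn0.
move=> + hb; elim/ltn_ind: a => a IH ha.
have [an|na] := ltnP a n; first by rewrite modn_small.
rewrite -{1}(subnK na) coord_period //; last by lia.
by rewrite IH; [rewrite -{2}(subnK na) modnDr | lia | lia].
Qed.

Lemma domino_ext (x y : domino_mor) : tag x = tag y ->
  (forall a b, (0 < n)%N -> (a < n + dblue x)%N -> (b <= dred x)%N ->
    coord x a b = coord y a b) -> x = y.
Proof.
case: x y => m f [p g] /= e; subst p => H; congr Tagged.
apply: val_inj; apply/ffunP => z; rewrite -!extendE.
have := fsvalP z; rewrite in_region => /and3P[h0 h1 h2].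
by have := H _ _ h0 h1 h2; rewrite /coord /= -pair_degE.
Qed.

Lemma domino_row_ext (x y : domino_mor) : tag x = tag y ->
  (forall b, (0 < n)%N -> (b <= dred x)%N -> exists2 c, (c <= dblue x)%N &
    forall a, (a < n)%N -> coord x (a + c) b = coord y (a + c) b) -> x = y.
Proof.
move=> e H; apply: domino_ext => // a b n0 ha hb.
have [c hc E] := H b n0 hb.
pose i := ((a + c * n.-1) %% n)%N.
have hi : (i < n)%N by rewrite ltn_mod.
have ei : ((i + c) %% n = a %% n)%N.
  rewrite modnDml -addnA -mulnSr prednK // mulnC -modnDmr modnMr addn0 //.
have eb : dblue y = dblue x by rewrite /dblue e.
have er : dred y = dred x by rewrite /dred e.
have hic : (i + c < n + dblue x)%N by lia.
have := E i hi.
rewrite (coord_mod hic hb) (@coord_mod y (i + c) b) ?eb ?er // ei => Ei.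
by rewrite (coord_mod ha hb) Ei [RHS]coord_mod ?eb ?er.
Qed.

Lemma sum_rot (u : nat -> 'Z_q) a : \sum_(i < n) u ((i + a) %% n)%N = \sum_(i < n) u i.
Proof.
elim: a => [|a <-].
  by apply: eq_bigr => i _; rewrite addn0 modn_small.
case: n => [|k]; first by rewrite !big_ord0.
rewrite big_ord_recr [RHS]big_ord_recl [LHS]addrC; congr (_ + _) => /=.
  by rewrite addnS -addSn modnDl.
by apply: eq_bigr => i _; rewrite /bump /= addnS.
Qed.

Lemma mk_path m (h : nat -> nat -> 'Z_q) :
  (forall a b, (a <= m blue)%N -> (b <= m red)%N -> \sum_(i < n) h (i + a)%N b = t) ->
  exists la : domino_path m, forall a b, (0 < n)%N -> (a < n + m blue)%N ->
    (b <= m red)%N -> extend (val la) (pair_deg a b) = h a b.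
Proof.
move=> H.
pose f : {ffun region m -> 'Z_q} := [ffun z : region m => h ((val z : mdeg 2) blue) ((val z : mdeg 2) red)].
have E a b : (0 < n)%N -> (a < n + m blue)%N -> (b <= m red)%N ->
    extend f (pair_deg a b) = h a b.
  move=> h0 h1 h2.
  have hz : pair_deg a b \in region m by rewrite in_region !degE h0 h1 h2.
  by have := extendE f [` hz]%fset; rewrite /= => ->; rewrite ffunE /= !degE.
have pf : is_domino_path f.
  apply/forallP => l; rewrite /is_vertex sum_tile.
  have := fsvalP l; rewrite in_box => /forallP hl.
  rewrite -(H _ _ (hl blue) (hl red)); apply/eqP; apply: eq_bigr => i _.
  rewrite extend_window // E //.
  - exact: leq_ltn_trans (leq0n i) (ltn_ord i).
  - exact: leq_add (ltn_ord i) (hl blue).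

by exists (exist _ f pf).
Qed.

Lemma vertex_ext (v w : vertex) :
  (forall a, (a < n)%N -> extend (val v) (pair_deg a 0) = extend (val w) (pair_deg a 0)) ->
  v = w.
Proof.
move=> H; apply: val_inj; apply/ffunP => z; rewrite -!extendE.
have := fsvalP z; rewrite in_tile => /andP[h0 /eqP h1].
have -> : val z = pair_deg (fsval z blue) 0 by exact: deg_flat.
exact: H.
Qed.

Lemma coord_rng x a : (a < n)%N -> extend (val (domino_rng x)) (pair_deg a 0) = coord x a 0.
Proof. by move=> an; rewrite extend_window //= !degE addn0. Qed.

Lemma coord_src x a : (a < n)%N ->
  extend (val (domino_src x)) (pair_deg a 0) = coord x (a + dblue x) (dred x).
Proof. by move=> an; rewrite extend_window //=. Qed.

Lemma composable_coord x y a : domino_src x = domino_rng y -> (a < n)%N ->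
  coord x (a + dblue x) (dred x) = coord y a 0.
Proof. by move=> h an; rewrite -coord_src // h coord_rng. Qed.

(* la(i) = mu(i) on T(m) and la(i + m) = nu(i) on T(p); such a path exists and
   is unique by [concat_subproof] and [is_concat_unique]. *)
Definition is_concat m p (mu : domino_path m) (nu : domino_path p)
    (la : domino_path (m + p)) : bool :=
  [forall x : region (m + p), forall y : region m,
     (val x == val y) ==> (val la x == val mu y)] &&
  [forall x : region (m + p), forall y : region p,
     (val x == val y + m) ==> (val la x == val nu y)].

Lemma is_concatP m p (mu : domino_path m) (nu : domino_path p)
    (la : domino_path (m + p)) :
  reflect ((0 < n)%N -> (forall a b, (a < n + m blue)%N -> (b <= m red)%N ->
      extend (val la) (pair_deg a b) = extend (val mu) (pair_deg a b)) /\
    (forall a b, (a < n + p blue)%N -> (b <= p red)%N ->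
      extend (val la) (pair_deg (a + m blue) (b + m red)) =
      extend (val nu) (pair_deg a b)))
  (is_concat mu nu la).
Proof.
apply: (iffP andP) => [[/forallP H1 /forallP H2] n0|H].
  split=> a b ha hb.
    have hx : pair_deg a b \in region (m + p).
      by rewrite in_region !degE n0; lia.
    have hy : pair_deg a b \in region m by rewrite in_region !degE n0 ha hb.
    have /forallP/(_ [` hy]%fset)/implyP/(_ (eqxx _))/eqP := H1 [` hx]%fset.
    by rewrite -!extendE.
  have hx : pair_deg (a + m blue) (b + m red) \in region (m + p).
    by rewrite in_region !degE n0; lia.
  have hy : pair_deg a b \in region p by rewrite in_region !degE n0 ha hb.
  have /forallP/(_ [` hy]%fset)/implyP := H2 [` hx]%fset.
  rewrite -!extendE /= => E; apply/eqP/E/eqP.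
  by rewrite [X in _ = _ + X]pair_degE pair_degD.
split; apply/forallP => x; apply/forallP => y; apply/implyP => /eqP e.
  have := fsvalP y; rewrite in_region => /and3P[n0 h1 h2].
  have [E _] := H n0.
  by have := E _ _ h1 h2; rewrite -pair_degE -{1}e !extendE => ->.
have := fsvalP y; rewrite in_region => /and3P[n0 h1 h2].
have [_ E] := H n0.
have := E _ _ h1 h2; rewrite -pair_degE -pair_degD -!pair_degE -{1}e !extendE => -> //.
Qed.

Lemma concat_subproof (x y : domino_mor) : domino_src x = domino_rng y ->
  exists la, is_concat (tagged x) (tagged y) la.
Proof.
move=> h.
pose g a b := if (b <= dred x)%N then coord x (a %% n) b
  else coord y ((a + dblue x * n.-1) %% n) (b - dred x).
have Hg a b : (a <= (tag x + tag y)%R blue)%N -> (b <= (tag x + tag y)%R red)%N ->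
    \sum_(i < n) g (i + a)%N b = t.
  rewrite !degE -!/(dblue _) -!/(dred _) => ha hb; have [hb'|hb'] := leqP b (dred x).
    under eq_bigr => i _ do rewrite /g hb'.
    have /= -> := sum_rot (fun i => coord x i b) a.
    rewrite -[RHS](@coord_sum x 0 b) //.
    by apply: eq_bigr => i _; rewrite addn0.
  under eq_bigr => i _ do rewrite /g leqNgt hb' /= -addnA.
  have /= -> := sum_rot (fun i => coord y i (b - dred x)) (a + dblue x * n.-1).
  have hb2 : (b - dred x <= dred y)%N by rewrite leq_subLR.
  rewrite -[RHS](@coord_sum y 0 (b - dred x)) //.
  by apply: eq_bigr => i _; rewrite addn0.
have [la E] := mk_path Hg.
exists la; apply/is_concatP => n0; split=> a b ha hb.
  have {}ha : (a < n + dblue x)%N := ha.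
  have {}hb : (b <= dred x)%N := hb.
  rewrite E // ?degE -?/(dblue _) -?/(dred _); [|lia|lia].
  by rewrite /g hb -coord_mod.
have {}ha : (a < n + dblue y)%N := ha.
have {}hb : (b <= dred y)%N := hb.
rewrite -[(tag x : mdeg 2) blue]/(dblue x) -[(tag x : mdeg 2) red]/(dred x).
rewrite E // ?degE -?/(dblue _) -?/(dred _); [|lia|lia].
have em : ((a + dblue x + dblue x * n.-1) %% n = a %% n)%N.
  by rewrite -addnA -mulnS prednK // mulnC -modnDmr modnMr addn0.
rewrite /g; case: leqP => hb'; last by rewrite em addnK -coord_mod.
have b0 : b = 0%N by lia.
rewrite b0 add0n -/(coord y a 0) (coord_mod (x := y) ha) // -(composable_coord h) ?ltn_mod //.
by rewrite [RHS]coord_mod ?modnDml // ltn_add2r ltn_mod.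
Qed.

Definition domino_comp (x y : domino_mor) (h : domino_src x = domino_rng y) : domino_mor :=
  Tagged domino_path (xchoose (concat_subproof h)).

Lemma domino_compP x y (h : domino_src x = domino_rng y) :
  is_concat (tagged x) (tagged y) (tagged (domino_comp h)).
Proof. exact: (xchooseP (concat_subproof h)). Qed.

Lemma coord_compl x y (h : domino_src x = domino_rng y) a b :
  (0 < n)%N -> (a < n + dblue x)%N -> (b <= dred x)%N ->
  coord (domino_comp h) a b = coord x a b.
Proof. by move=> n0 ha hb; have [E _] := is_concatP _ _ _ (domino_compP h) n0; exact: E. Qed.

Lemma coord_compr x y (h : domino_src x = domino_rng y) a b :
  (0 < n)%N -> (a < n + dblue y)%N -> (b <= dred y)%N ->
  coord (domino_comp h) (a + dblue x) (b + dred x) = coord y a b.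
Proof. by move=> n0 ha hb; have [_ E] := is_concatP _ _ _ (domino_compP h) n0; exact: E. Qed.

Lemma dblue_comp x y (h : domino_src x = domino_rng y) :
  dblue (domino_comp h) = (dblue x + dblue y)%N.
Proof. exact: mdegD. Qed.

Lemma dred_comp x y (h : domino_src x = domino_rng y) :
  dred (domino_comp h) = (dred x + dred y)%N.
Proof. exact: mdegD. Qed.

Lemma is_concat_unique m p (mu : domino_path m) (nu : domino_path p)
    (la la' : domino_path (m + p)) :
  is_concat mu nu la -> is_concat mu nu la' -> la = la'.
Proof.
move=> /is_concatP H /is_concatP H'.
suff : Tagged domino_path la = Tagged domino_path la' by exact: eq_from_Tagged.
have er : dred (Tagged domino_path la) = (m red + p red)%N by exact: mdegD.
have eb : dblue (Tagged domino_path la) = (m blue + p blue)%N by exact: mdegD.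
apply: domino_row_ext => // b n0; rewrite er eb => hb.
have [A B] := H n0; have [A' B'] := H' n0.
have [h|h] := leqP b (m red).
  by exists 0%N => // a an; rewrite /coord A ?A' //; lia.
exists (m blue); first by lia.
by move=> a an; rewrite -(subnK (ltnW h)) /coord B ?B' //; lia.
Qed.

Lemma region0 (x : mdeg 2) : x \in region 0 -> x \in tile.
Proof. by rewrite in_region in_tile !degE addn0 leqn0 => /and3P[_ -> ->]. Qed.

Definition domino_id_fun (v : vertex) : {ffun region 0 -> 'Z_q} :=
  [ffun x => val v [` region0 (fsvalP x)]%fset].

Lemma coord_id_fun v a : (a < n)%N ->
  extend (domino_id_fun v) (pair_deg a 0) = extend (val v) (pair_deg a 0).
Proof.
move=> an.
have hx : pair_deg a 0 \in region 0 by rewrite in_region !degE addn0 an; lia.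
have -> : pair_deg a 0 = val [` hx]%fset by [].
by rewrite extendE ffunE -extendE.
Qed.

Lemma domino_id_subproof v : is_domino_path (domino_id_fun v).
Proof.
apply/forallP => l; rewrite /is_vertex sum_tile.
have := valP v; rewrite /is_vertex sum_tile => /eqP <-; apply/eqP.
have := fsvalP l; rewrite in_box => /forallP hl.
apply: eq_bigr => i _; rewrite extend_window //.
have := hl blue; have := hl red; rewrite !degE !leqn0 => /eqP -> /eqP ->.
by rewrite addn0 coord_id_fun.
Qed.

Definition domino_id (v : vertex) : domino_mor :=
  Tagged domino_path
    (exist (fun f => is_domino_path f) (domino_id_fun v) (domino_id_subproof v)
      : domino_path 0).

Lemma coord_id v a : (a < n)%N -> coord (domino_id v) a 0 = extend (val v) (pair_deg a 0).
Proof. exact: coord_id_fun. Qed.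

Fact domino_rng_id v : domino_rng (domino_id v) = v.
Proof. by apply: vertex_ext => a an; rewrite coord_rng // coord_id. Qed.

Fact domino_src_id v : domino_src (domino_id v) = v.
Proof.
apply: vertex_ext => a an; rewrite coord_src //.
have -> : dblue (domino_id v) = 0%N by exact: mdeg0.
have -> : dred (domino_id v) = 0%N by exact: mdeg0.
by rewrite addn0 coord_id.
Qed.

Fact domino_rng_comp x y (h : domino_src x = domino_rng y) :
  domino_rng (domino_comp h) = domino_rng x.
Proof. by apply: vertex_ext => a an; rewrite !coord_rng // coord_compl //; lia. Qed.

Fact domino_src_comp x y (h : domino_src x = domino_rng y) :
  domino_src (domino_comp h) = domino_src y.
Proof.
apply: vertex_ext => a an; rewrite !coord_src // dblue_comp dred_comp.
have n0 : (0 < n)%N by exact: leq_ltn_trans an.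
rewrite -(coord_compr h n0) ?ltn_add2r //.
by congr coord; [rewrite addnA addnAC | rewrite addnC].
Qed.

Fact domino_comp_idl x (h : domino_src (domino_id (domino_rng x)) = domino_rng x) :
  domino_comp h = x.
Proof.
apply/esym/domino_ext => [|a b n0 ha hb]; first by rewrite /= add0r.
have := coord_compr h n0 ha hb.
have -> : dblue (domino_id (domino_rng x)) = 0%N by exact: mdeg0.
have -> : dred (domino_id (domino_rng x)) = 0%N by exact: mdeg0.
by rewrite !addn0.
Qed.

Fact domino_comp_idr x (h : domino_src x = domino_rng (domino_id (domino_src x))) :
  domino_comp h = x.
Proof.
apply/esym/domino_ext => [|a b n0 ha hb]; first by rewrite /= addr0.
by rewrite coord_compl.
Qed.

Fact domino_compA x y z (h1 : domino_src x = domino_rng y)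
  (h2 : domino_src (domino_comp h1) = domino_rng z)
  (h3 : domino_src y = domino_rng z)
  (h4 : domino_src x = domino_rng (domino_comp h3)) :
  domino_comp h2 = domino_comp h4.
Proof.
apply: domino_row_ext => [|b n0] /=; first by rewrite addrA.
rewrite !dred_comp !dblue_comp => hb.
have [b1|b1] := leqP b (dred x).
  exists 0%N => // a an.
  by rewrite (coord_compl h2) ?(coord_compl h1) ?(coord_compl h4) // ?dblue_comp ?dred_comp; lia.
have [b2|b2] := leqP b (dred x + dred y).
  exists (dblue x); first by lia.
  move=> a an; rewrite (coord_compl h2) // ?dblue_comp ?dred_comp; [|lia|lia].
  rewrite -(subnK (ltnW b1)) (coord_compr h1) ?(coord_compr h4) //
    ?(coord_compl h3) // ?dblue_comp ?dred_comp; lia.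
exists (dblue x + dblue y)%N; first by lia.
move=> a an; pose c := (b - dred x - dred y)%N.
transitivity (coord z a c).
  have -> : b = (c + dred (domino_comp h1))%N by rewrite dred_comp /c; lia.
  by rewrite -dblue_comp coord_compr //; rewrite /c; lia.
have -> : b = (c + dred y + dred x)%N by rewrite /c; lia.
have -> : (a + (dblue x + dblue y) = a + dblue y + dblue x)%N by lia.
by rewrite coord_compr ?coord_compr // ?dblue_comp ?dred_comp /c; lia.
Qed.

Fact domino_deg_id v : domino_deg (domino_id v) = 0.
Proof. by []. Qed.

Fact domino_deg_comp x y (h : domino_src x = domino_rng y) :
  domino_deg (domino_comp h) = domino_deg x + domino_deg y.
Proof. by []. Qed.

Fact domino_factorisation x m p : domino_deg x = m + p ->
  exists! mn : domino_mor * domino_mor,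
    [/\ domino_deg mn.1 = m, domino_deg mn.2 = p &
      exists h : domino_src mn.1 = domino_rng mn.2, x = domino_comp h].
Proof.
case: x => d f; rewrite /domino_deg /= => e; subst d.
pose x : domino_mor := Tagged domino_path f.
rewrite -/x.
have xb : dblue x = (m blue + p blue)%N by exact: mdegD.
have xr : dred x = (m red + p red)%N by exact: mdegD.
have Hmu a b : (a <= m blue)%N -> (b <= m red)%N ->
    \sum_(i < n) coord x (i + a) b = t.
  by move=> ha hb; apply: coord_sum; rewrite ?xb ?xr; lia.
have Hnu a b : (a <= p blue)%N -> (b <= p red)%N ->
    \sum_(i < n) coord x (i + a + m blue) (b + m red) = t.
  move=> ha hb; under eq_bigr => i _ do rewrite -addnA.
  by apply: coord_sum; rewrite ?xb ?xr; lia.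
have [mu Emu] := @mk_path m (coord x) Hmu.
have [nu Enu] := @mk_path p (fun a b => coord x (a + m blue) (b + m red)) Hnu.
pose x1 : domino_mor := Tagged domino_path mu.
pose x2 : domino_mor := Tagged domino_path nu.
have h : domino_src x1 = domino_rng x2.
  apply: vertex_ext => a an; rewrite coord_src // coord_rng //.
  have n0 : (0 < n)%N by exact: leq_ltn_trans an.
  rewrite [LHS](Emu _ _ n0) ?ltn_add2r // [RHS](Enu a 0%N n0) ?add0n //.
  by rewrite ltn_addr.
exists (x1, x2); split.
  split=> //; exists h; apply: domino_row_ext => // b n0; rewrite xr xb => hb.
  have [b1|b1] := leqP b (m red).
    exists 0%N => // a an; rewrite [RHS](coord_compl h n0) //; last 1 first.
      by rewrite addn0 ltn_addr.
    by rewrite [RHS]Emu // addn0 ltn_addr.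
  exists (m blue); first by lia.
  have hb' : (b - m red <= p red)%N by lia.
  move=> a an; rewrite -(subnK (ltnW b1)) [RHS](coord_compr h n0) ?ltn_addr //.
  by rewrite [RHS]Enu ?ltn_addr.
case=> y1 y2 /= [d1 d2 [h' e]]; subst m p.
congr pair; apply: domino_ext => // a b n0 ha hb.
  by rewrite -(coord_compl h') // -e [LHS]Emu.
by rewrite -(coord_compr h') // -e [LHS]Enu.
Qed.

Definition domino : kgraph 2 := KGraph domino_rng_id domino_src_id
  domino_rng_comp domino_src_comp domino_comp_idl domino_comp_idr
  domino_compA domino_deg_id domino_deg_comp domino_factorisation.

Lemma blue_edge_subproof (v : obj domino) :
  exists e : layer domino (unit_deg blue), rng (val e) == v.
Proof.
pose g a (b : nat) := extend (val v) (pair_deg (a %% n) 0).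
have Hg a b : (a <= unit_deg blue blue)%N -> (b <= unit_deg blue red)%N ->
    \sum_(i < n) g (i + a)%N b = t.
  move=> _ _; have /= := sum_rot (fun a => extend (val v) (pair_deg a 0)) a.
  by rewrite -sum_tile => ->; apply/eqP/(valP v).
have [f E] := mk_path Hg.
have he : deg (Tagged domino_path f : mor domino) == unit_deg blue by [].
exists (exist (fun e => deg e == unit_deg blue) (Tagged domino_path f : mor domino) he).
apply/eqP/vertex_ext => a an; rewrite coord_rng //.
have n0 : (0 < n)%N by exact: leq_ltn_trans an.
by rewrite [LHS](E a 0%N) // /g ?modn_small // ltn_addr.
Qed.

Lemma blue_edge_unique (e f : layer domino (unit_deg blue)) :
  rng (val e) = rng (val f) -> e = f.
Proof.
case: e f => [e he] [f hf] /= h; apply: val_inj => /=.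
have de := eqP he; have df := eqP hf.
have ee : tag e = tag f by rewrite [LHS]de [RHS]df.
have er : dred e = 0%N by rewrite /dred [tag e]de unit_deg_blue degE.
apply: domino_row_ext => // b n0; rewrite er leqn0 => /eqP ->.
by exists 0%N => // a an; rewrite addn0 -!coord_rng // [domino_rng e]h.
Qed.

Definition blue_edge (v : obj domino) : layer domino (unit_deg blue) :=
  xchoose (blue_edge_subproof v).

Definition sigma (v : obj domino) : obj domino := src (val (blue_edge v)).

Lemma sigma_spec (e : layer domino (unit_deg blue)) :
  sigma (rng (val e)) = src (val e).
Proof.
rewrite /sigma; congr (src (val _)); apply: blue_edge_unique.
by apply/eqP; apply: (xchooseP (blue_edge_subproof _)).
Qed.

End Domino.

(* Main.v *)
(* A path of degree (a, b) is n-periodic along each of its rows (compare the sums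
   over two adjacent tiles), so it is determined by a together with its b + 1 rows
   read off at blue coordinates 0, ..., n - 1, and these rows are arbitrary
   vertices.  Hence a red edge is just a pair of vertices, sigma is cyclic rotation
   of a vertex, and a path is a red path along its left column together with the
   number a.  In a composite the rows of the second factor reappear in the left
   column rotated back a times, which is the crossed product composition. *)
Require Import Defs.
From mathcomp Require Import all_boot all_order all_algebra finmap.
From mathcomp Require Import zify.
(* again, since ssrfun.comp would otherwise hide the composition of k-graphs *)
Import Defs.
Set Implicit Arguments.
Unset Strict Implicit.
Unset Printing Implicit Defensive.
Import GRing.Theory.
Local Open Scope ring_scope.

(** * Isomorphisms from bijective morphisms *)

Lemma inj_surj_bij (T : choiceType) (U : eqType) (f : T -> U) :
  injective f -> (forall u, exists x, f x = u) -> bijective f.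
Proof.
(* The boolean form lets [xchoose] select preimages constructively. *)
move=> inj surj; have surjb u : exists x, f x == u.
  by have [x <-] := surj u; exists x.
have fK : cancel (fun u => xchoose (surjb u)) f.
  by move=> u; apply/eqP/(xchooseP (surjb u)).
by exists (fun u => xchoose (surjb u)) => // x; apply/inj/fK.
Qed.

(** Objects are seen through their identity morphisms, so the inverse on morphisms already yields
    the inverse [go] on objects; each law for [g] is transported back along [f]. *)
Lemma bij_kmorphism_kiso k (G H : kgraph k) (f : kmorphism G H) :
  bijective (fmor f) -> inhabited (kiso G H).
Proof.
case=> g fK gK; pose go w := rng (g (idm w)).
have fobjK v : go (fobj f v) = v by rewrite /go -fmor_id fK rng_id.
have g_rng mu : rng (g mu) = go (rng mu).
  by rewrite -{2}[mu]gK fmor_rng fobjK.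
have g_src mu : src (g mu) = go (src mu).
  by rewrite -{2}[mu]gK fmor_src fobjK.
have g_id w : g (idm w) = idm (go w).
  apply: (can_inj fK); rewrite gK fmor_id; congr idm.
  by rewrite /go -fmor_rng gK rng_id.
have g_comp mu nu (h : src mu = rng nu) (h' : src (g mu) = rng (g nu)) :
    g (comp h) = comp h'.
  have h2 : src (fmor f (g mu)) = rng (fmor f (g nu)) by rewrite !gK.
  apply: (can_inj fK); rewrite (fmor_comp f h' h2) gK.
  by apply: comp_eq; rewrite gK.
have g_deg mu : deg (g mu) = deg mu by rewrite -{2}[mu]gK fmor_deg.
exact: (inhabits (@KIso k G H f (KMorphism g_rng g_src g_id g_comp g_deg) fK gK)).
Qed.

(** * Paths in a directed graph and the action generated by an automorphism *)

Lemma dpath_ext (D : digraph) (x y : dpath D) :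
  (forall e f : edge D, drng e = drng f -> dsrc e = dsrc f -> e = f) ->
  (val x).1 = (val y).1 ->
  [seq dsrc e | e <- (val x).2] = [seq dsrc e | e <- (val y).2] -> x = y.
Proof.
case: x y => -[v s] hs [[w u] hu] /= edge_ext evw; subst w => E.
apply: val_inj => /=; congr pair.
elim: s u v hs hu E => [[]|e s IH [|f u] v] //=.
move=> /andP[/eqP ev hs] /andP[/eqP fv hu] [es E].
(* Both tails now start at [dsrc e], so induction applies; the first edges have equal ends, hence
   agree. *)
rewrite -es in hu.
by rewrite (IH _ _ hs hu E) (edge_ext e f) // ev fv.
Qed.

Section GeneratedPathAction.
Variables (D : digraph) (A : diso D D).
Let a := generated_action (path_iso A).

Lemma generated_obj (m : nat) (v : vert D) : fobj (a m) v = iter m (dvert A) v.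
Proof. by rewrite /a /=; elim: m => //= m ->. Qed.

Lemma generated_objN (m : nat) (v : vert D) :
  fobj (a (- m%:Z)) v = iter m (dvert (dinv A)) v.
Proof.
(* Since [a (- m)] cancels [a m], only nonnegative powers need computing. *)
suff e : fobj (a m) (iter m (dvert (dinv A)) v) = v by rewrite -{1}e zact_objK.
rewrite generated_obj; elim: m v => // m IH v.
by rewrite iterS iterSr IH dvertKV.
Qed.

Lemma generated_path_vertices (m : nat) (x : dpath D) :
  [seq dsrc e | e <- (val (fmor (a m) x : dpath D)).2] =
  [seq iter m (dvert A) v | v <- [seq dsrc e | e <- (val x).2]].
Proof.
rewrite /a /=; elim: m => [|m IH] /=; first by rewrite map_id.
rewrite (map_comp (dvert A)) -IH -!map_comp.
by apply: eq_map => e /=; rewrite dedge_src.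
Qed.

End GeneratedPathAction.

(** * Rows of a domino path *)

Section DominoRows.
Variables (n q : nat) (t : 'Z_q) (n_gt0 : (0 < n)%N).
Implicit Types (x y : domino_mor n t) (v w : vertex n t).

(** The height is capped so that rows can be indexed by any natural number, without a bound
    proof. *)
Lemma row_in_box x b : pair_deg 0 (minn b (dred x)) \in box (tag x).
Proof.
rewrite in_box; apply/forallP => j.
by case: (blue_or_red j) => ->; rewrite degE ?geq_minr.
Qed.

(* Rows above the top one are all equal to the top one. *)
Definition row x b : vertex n t := domino_vertex [` row_in_box x b]%fset.

Lemma coord_row x a b : (a < n)%N -> (b <= dred x)%N ->
  extend (val (row x b)) (pair_deg a 0) = coord x a b.
Proof.
by move=> an hb; rewrite extend_window //= !degE addn0 (minn_idPl hb).
Qed.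

Lemma row_rng x : row x 0 = domino_rng x.
Proof. by apply: vertex_ext => a an; rewrite coord_row // coord_rng. Qed.

(** By blue periodicity, the first [n] entries of a row fix all of it. *)
Lemma row_ext x y : tag x = tag y ->
  (forall b, (b <= dred x)%N -> row x b = row y b) -> x = y.
Proof.
move=> e H; apply: domino_row_ext => // b _ hb; exists 0%N => // a an.
have hb' : (b <= dred y)%N by rewrite /dred -e.
by rewrite addn0 -!coord_row // H.
Qed.

Lemma vertex_sum_rot v a :
  \sum_(i < n) extend (val v) (pair_deg ((i + a) %% n) 0) = t.
Proof.
have /= -> := @sum_rot n q (fun a => extend (val v) (pair_deg a 0)) a.
by rewrite -sum_tile; apply/eqP/(valP v).
Qed.

(** Each [f b] is repeated periodically in the blue direction. Every window of row [b] is then a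
    rotation of [f b], with the same sum, and no condition links different rows. *)
Lemma exists_rows m (f : nat -> vertex n t) : exists x,
  tag x = m /\ forall b, (b <= m red)%N -> row x b = f b.
Proof.
have [la E] := @mk_path n q t m
  (fun a b => extend (val (f b)) (pair_deg (a %% n) 0))
  (fun a b _ _ => vertex_sum_rot (f b) a).
exists (Tagged (@domino_path n q t) la); split=> // b hb.
apply: vertex_ext => a an; rewrite coord_row // [LHS]E ?modn_small //.
exact: ltn_addr.
Qed.

(** * The blue shift as a rotation *)

Lemma extend_sigma v a : (a < n)%N ->
  extend (val (sigma v)) (pair_deg a 0) =
  extend (val v) (pair_deg (a.+1 %% n) 0).
Proof.
move=> an; pose e := blue_edge v.
have ev : rng (val e) = v by apply/eqP/(xchooseP (blue_edge_subproof v)).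
have db : dblue (val e) = 1%N.
  by rewrite /dblue [tag _](eqP (valP e)) unit_deg_blue degE.
have dr : dred (val e) = 0%N.
  by rewrite /dred [tag _](eqP (valP e)) unit_deg_blue degE.
rewrite -{2}ev /sigma -/e coord_src // coord_rng ?ltn_mod // db dr addn1.
(* Source and range are windows of the single row of [e], one place apart; periodicity wraps
   position [n] round to 0. *)
by rewrite coord_mod ?db ?dr //; lia.
Qed.

Lemma extend_iter_sigma v m a : (a < n)%N ->
  extend (val (iter m (@sigma n q t) v)) (pair_deg a 0) =
  extend (val v) (pair_deg ((a + m) %% n) 0).
Proof.
elim: m a => [|m IH] a an; first by rewrite addn0 modn_small.
by rewrite iterS extend_sigma // IH ?ltn_mod // modnDml addSnnS.
Qed.

Lemma iter_sigma_n v : iter n (@sigma n q t) v = v.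
Proof.
by apply: vertex_ext => a an; rewrite extend_iter_sigma // modnDr modn_small.
Qed.

(** The [n]-th power of the rotation is the identity, so its inverse is the power [n.-1]. *)
Definition sigma_inv : vertex n t -> vertex n t := iter n.-1 (@sigma n q t).

Lemma sigmaK : cancel (@sigma n q t) sigma_inv.
Proof. by move=> v; rewrite /sigma_inv -iterSr prednK // iter_sigma_n. Qed.

Lemma sigma_invK : cancel sigma_inv (@sigma n q t).
Proof. by move=> v; rewrite /sigma_inv -iterS prednK // iter_sigma_n. Qed.

Lemma iter_sigmaK m : cancel (iter m (@sigma n q t)) (iter m sigma_inv).
Proof. by elim: m => // m IH v; rewrite iterSr iterS sigmaK IH. Qed.

Lemma iter_sigma_invK m : cancel (iter m sigma_inv) (iter m (@sigma n q t)).
Proof. by elim: m => // m IH v; rewrite iterSr iterS sigma_invK IH. Qed.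

(** The source is the window of the top row that starts at column [dblue x]; each step to the right
    is one rotation. *)
Lemma row_src x : domino_src x = iter (dblue x) (@sigma n q t) (row x (dred x)).
Proof.
apply: vertex_ext => a an.
rewrite coord_src // extend_iter_sigma // coord_row ?ltn_mod //.
by rewrite coord_mod // ltn_add2r.
Qed.

Lemma row_compl x y (h : domino_src x = domino_rng y) b : (b <= dred x)%N ->
  row (domino_comp h) b = row x b.
Proof.
move=> hb; apply: vertex_ext => a an.
rewrite !coord_row ?coord_compl ?dred_comp //; first exact: ltn_addr.
exact: leq_trans hb (leq_addr _ _).
Qed.

(** In the composite the second factor sits [dblue x] columns to the right, so reading it from
    column 0 undoes that many rotations. *)
Lemma row_compr x y (h : domino_src x = domino_rng y) b : (b <= dred y)%N ->
  row (domino_comp h) (dred x + b) = iter (dblue x) sigma_inv (row y b).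
Proof.
(* Rotating both sides forward moves to the columns where [coord_compr] applies. *)
move=> hb; apply: (can_inj (iter_sigmaK (dblue x))).
apply: vertex_ext => a an.
have hb2 : (dred x + b <= dred (domino_comp h))%N.
  by rewrite dred_comp leq_add2l.
rewrite iter_sigma_invK extend_iter_sigma // !coord_row ?ltn_mod //.
rewrite -(coord_compr h) //; last exact: ltn_addr.
rewrite [in RHS](addnC b) [RHS]coord_mod // dblue_comp; lia.
Qed.

(** * The red graph *)

Local Notation RL := (coordinate_graph (domino n t) red).

Lemma red_edge_deg (e : edge RL) : dblue (val e) = 0%N /\ dred (val e) = 1%N.
Proof.
have de : tag (val e) = unit_deg red := eqP (valP e).
by rewrite /dblue /dred de !ffunE.
Qed.

Lemma red_edge_ends (e : edge RL) :
  drng e = row (val e) 0 /\ dsrc e = row (val e) 1.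
Proof.
have [db dr] := red_edge_deg e; split; first by rewrite row_rng.
by rewrite [LHS]row_src db dr.
Qed.

(** A red edge has just two rows, and these are its range and its source. *)
Lemma red_edge_ext (e f : edge RL) : drng e = drng f -> dsrc e = dsrc f -> e = f.
Proof.
have [er es] := red_edge_ends e; have [fr fs] := red_edge_ends f.
rewrite er es fr fs => e0 e1; apply/val_inj/row_ext.
  by rewrite [LHS](eqP (valP e)) [RHS](eqP (valP f)).
by have [_ ->] := red_edge_deg e; case=> [|[|]].
Qed.

Lemma red_edge_exists v w : exists e : edge RL, (drng e == v) && (dsrc e == w).
Proof.
have [x [dx rx]] := exists_rows (unit_deg red) (fun b => if b == 0%N then v else w).
have hx : deg (x : mor (domino n t)) == unit_deg red by rewrite -dx.
pose e : edge RL := exist (fun e => deg e == unit_deg red) (x : mor (domino n t)) hx.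
by exists e; have [-> ->] := red_edge_ends e; rewrite !rx ?ffunE ?eqxx.
Qed.

Definition red_edge v w : edge RL := xchoose (red_edge_exists v w).

Lemma drng_red_edge v w : drng (red_edge v w) = v.
Proof. by have /andP[/eqP] := xchooseP (red_edge_exists v w). Qed.

Lemma dsrc_red_edge v w : dsrc (red_edge v w) = w.
Proof. by have /andP[_ /eqP] := xchooseP (red_edge_exists v w). Qed.

(** With exactly one red edge for each ordered pair of vertices, every vertex map extends to edges
    in a unique way. *)
Definition map_red_edge (f : vertex n t -> vertex n t) (e : edge RL) : edge RL :=
  red_edge (f (drng e)) (f (dsrc e)).

Lemma map_red_edge_src f e : dsrc (map_red_edge f e) = f (dsrc e).
Proof. exact: dsrc_red_edge. Qed.

Lemma map_red_edge_rng f e : drng (map_red_edge f e) = f (drng e).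
Proof. exact: drng_red_edge. Qed.

Lemma map_red_edgeK f g : cancel f g -> cancel (map_red_edge f) (map_red_edge g).
Proof.
by move=> fK e; apply: red_edge_ext;
  rewrite ?map_red_edge_src ?map_red_edge_rng fK.
Qed.

Definition red_diso (f g : vertex n t -> vertex n t) (fK : cancel f g)
    (gK : cancel g f) : diso RL RL :=
  @DIso RL RL
    (@DMorphism RL RL f _ (map_red_edge_src f) (map_red_edge_rng f))
    (@DMorphism RL RL g _ (map_red_edge_src g) (map_red_edge_rng g))
    fK gK (map_red_edgeK fK) (map_red_edgeK gK).

(** * Red paths as sequences of vertices *)

Fixpoint red_walk v (ws : seq (vertex n t)) : seq (edge RL) :=
  if ws is w :: ws' then red_edge v w :: red_walk w ws' else [::].

Lemma red_walk_path v ws : is_dpath (v : vert RL) (red_walk v ws).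
Proof.
elim: ws v => //= w ws IH v.
by have /= -> := drng_red_edge v w; have /= -> := dsrc_red_edge v w; rewrite eqxx IH.
Qed.

Lemma map_dsrc_red_walk v ws : [seq dsrc e | e <- red_walk v ws] = ws.
Proof. by elim: ws v => //= w ws IH v; rewrite IH; have /= -> := dsrc_red_edge v w. Qed.

Lemma red_path_ext (x y : dpath RL) : (val x).1 = (val y).1 ->
  [seq dsrc e | e <- (val x).2] = [seq dsrc e | e <- (val y).2] -> x = y.
Proof. exact/dpath_ext/red_edge_ext. Qed.

(** Row 0 is left out: it is the range, which a [dpath] stores separately. *)
Definition upper_rows x := mkseq (fun b => row x b.+1) (dred x).

Lemma last_rows x : last (row x 0) (upper_rows x) = row x (dred x).
Proof.
(* If [dred x] is 0, the list is empty and [last] returns [row x 0]. *)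
rewrite /upper_rows; case: (dred x) => // b.
by rewrite -nth_last size_mkseq nth_mkseq.
Qed.

Definition rows_path x : dpath RL := DPath (red_walk_path (row x 0) (upper_rows x)).

Lemma rows_path_vertices x : [seq dsrc e | e <- (val (rows_path x)).2] = upper_rows x.
Proof. exact: map_dsrc_red_walk. Qed.

Lemma size_rows_path x : size (val (rows_path x)).2 = dred x.
Proof. by rewrite -(size_map dsrc) rows_path_vertices size_mkseq. Qed.

(** * The isomorphism onto the crossed product *)

Let A := red_diso sigmaK sigma_invK.
(** The generator is the inverse of [A]: the power [m] acts on vertices by [iter m sigma_inv], as in
    [row_compr], and the power [- m] in the source map acts by [iter m sigma], as in [row_src]. *)
Let C := crossed_product (generated_action (path_iso (diso_inv A))).

Definition to_crossed x : mor C := (rows_path x, dblue x).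

Lemma to_crossed_rng x : rng (to_crossed x) = domino_rng x.
Proof. exact: row_rng. Qed.

Lemma to_crossed_src x : src (to_crossed x) = domino_src x.
Proof.
rewrite /= /crossed_src [fobj _ _]generated_objN row_src.
by rewrite /= /dpath_src rows_path_vertices last_rows.
Qed.

Lemma to_crossed_deg x : deg (to_crossed x) = domino_deg x.
Proof.
rewrite /= /crossed_deg /= ffunE size_rows_path.
by rewrite [RHS]pair_degE.
Qed.

Lemma to_crossed_id v : to_crossed (domino_id v) = idm (v : obj C).
Proof.
have db : dblue (domino_id v) = 0%N by exact: mdeg0.
have dr : dred (domino_id v) = 0%N by exact: mdeg0.
rewrite /to_crossed db; congr pair; apply: red_path_ext.
  by rewrite /= row_rng domino_rng_id.
by rewrite rows_path_vertices /upper_rows dr.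
Qed.

Lemma to_crossed_comp x y (h : domino_src x = domino_rng y)
    (h' : src (to_crossed x) = rng (to_crossed y)) :
  to_crossed (domino_comp h) = comp h'.
Proof.
rewrite /to_crossed /= /crossed_comp /= dblue_comp; congr pair.
apply: red_path_ext; first by rewrite /= row_compl.
rewrite rows_path_vertices [RHS]map_cat rows_path_vertices.
rewrite generated_path_vertices rows_path_vertices /upper_rows.
rewrite dred_comp /mkseq iotaD map_cat; congr cat.
  by apply/eq_in_map => b; rewrite mem_iota => /= hb; rewrite row_compl.
(* Index [dred x + b] stands for row [dred x + b.+1], which comes from row [b.+1] of [y]. Row 0 of
   [y], rotated back, is the top row of [x] and is not repeated. *)
rewrite add0n -[X in iota X _]addn0 iotaDl -!map_comp.
apply/eq_in_map => b; rewrite mem_iota => /= hb.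
by rewrite -addnS row_compr.
Qed.

Definition crossed_functor : kmorphism (domino n t) C :=
  @KMorphism 2 (domino n t) C id to_crossed to_crossed_rng to_crossed_src
    to_crossed_id to_crossed_comp to_crossed_deg.

(** The degree fixes the shape, the range of the red path fixes row 0, and its further vertices fix
    the other rows. *)
Lemma to_crossed_inj : injective to_crossed.
Proof.
move=> x y e; have := congr1 deg e; rewrite !to_crossed_deg /domino_deg => d.
apply: row_ext => // b hb.
have er : dred y = dred x by rewrite /dred d.
have e0 : row x 0 = row y 0 := congr1 (fun z : mor C => (val z.1).1) e.
have := congr1 (fun z : mor C => [seq dsrc f | f <- (val z.1).2]) e.
rewrite /= !rows_path_vertices => e1; case: b hb => // b hb.
have := congr1 (fun s => nth (row x 0) s b) e1.
by rewrite !nth_mkseq ?er.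
Qed.

Lemma to_crossed_surj (z : mor C) : exists x, to_crossed x = z.
Proof.
(* The vertices visited by [p] serve as rows. There is one more of them than edges, so [nth] stays
   in range on rows 0 to [size (val p).2]. *)
case: z => p m; pose vs := (val p).1 :: [seq dsrc e | e <- (val p).2].
have [x [dx rx]] := exists_rows (pair_deg m (size (val p).2)) (nth (val p).1 vs).
rewrite degE in rx.
have db : dblue x = m by rewrite /dblue dx degE.
have dr : dred x = size (val p).2 by rewrite /dred dx degE.
exists x; rewrite /to_crossed db; congr pair; apply: red_path_ext.
  by rewrite /= rx.
rewrite rows_path_vertices; apply: (@eq_from_nth _ (val p).1).
  by rewrite size_mkseq size_map.
by move=> b; rewrite size_mkseq => hb; rewrite nth_mkseq // rx // -dr.
Qed.

End DominoRows.

Theorem proposition4p6 (n q : nat) (t : 'Z_q) (hn : (2 <= n)%N) (hq : (2 <= q)%N) :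
  let L : kgraph 2 := domino n t in
  let RL : digraph := coordinate_graph L red in
  exists sigma1 : edge RL -> edge RL,
    [/\ forall e : edge RL,
          unique (fun f : edge RL =>
            dsrc f = sigma (dsrc e) /\ drng f = sigma (drng e)) (sigma1 e),
        bijective sigma1
      & exists A : diso RL RL,
          [/\ dvert A =1 @sigma n q t,
              dedge A =1 sigma1
            & inhabited (kiso L
                (crossed_product
                  (generated_action (path_iso (diso_inv A)))))]].
Proof.
have n_gt0 : (0 < n)%N := ltnW hn.
move=> L RL; exists (map_red_edge n_gt0 (@sigma n q t)); split.
- move=> e; split; first by rewrite map_red_edge_src map_red_edge_rng.
  move=> f [fs fr]; apply: red_edge_ext => //.
    by rewrite map_red_edge_rng fr.
  by rewrite map_red_edge_src fs.
- by exists (map_red_edge n_gt0 (@sigma_inv n q t)); apply: map_red_edgeK;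
    [exact: sigmaK | exact: sigma_invK].
(* Its vertex and edge maps are the required ones by computation; only the isomorphism remains. *)
- exists (red_diso n_gt0 (sigmaK n_gt0) (sigma_invK n_gt0)); split=> //.
  apply: (bij_kmorphism_kiso (f := crossed_functor t n_gt0)).
  exact: inj_surj_bij (@to_crossed_inj _ _ _ _) (@to_crossed_surj _ _ _ _).
Qed.
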